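(* Let $n$ be a positive integer and let $p$ be a prime dividing $n$. Let $\omega_1:=e^{2\pi i/p}$, $\omega_j:=\omega_1^j$ for $0\le j\le p-1$, and $B:=\{1,\omega_1,\ldots,\omega_{p-1}\}^n\subseteq\mathbb{C}^n$. Let $K(n,p)$ be the minimum $k$ for which there exist vectors $v_1,\ldots,v_k\in B$ such that for every $w\in B$ there is an $i\in\{1,\ldots,k\}$ with $v_i\cdot w=0$. Then $K(n,p)\ge n(p-1)$.
   Context: Here $v\cdot w=\sum_{l=1}^n v_l w_l$ denotes the usual (bilinear, non-conjugated) scalar product of $v=(v_1,\dots,v_n)$ and $w=(w_1,\dots,w_n)$. *)

(* Defs.v *)
From HB Require Import structures.
From mathcomp Require Import all_boot all_order all_algebra all_field.
Set Implicit Arguments. Unset Strict Implicit. Unset Printing Implicit Defensive.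
Import Order.TTheory GRing.Theory Num.Theory.
Local Open Scope ring_scope.

Definition powset (p : nat) (w : algC) (x : algC) : Prop :=
  exists j : nat, (j < p)%N /\ x = w ^+ j.

Definition inB (n p : nat) (w : algC) (v : 'rV[algC]_n) : Prop :=
  forall l : 'I_n, powset p w (v 0 l).

Definition dot (n : nat) (v u : 'rV[algC]_n) : algC :=
  \sum_(l < n) v 0 l * u 0 l.

(* Main.v *)
Require Import Defs.
From HB Require Import structures.
From mathcomp Require Import all_boot all_order all_algebra all_field.
From mathcomp Require Import zify.
Set Implicit Arguments.
Unset Strict Implicit.
Unset Printing Implicit Defensive.
Import Order.TTheory GRing.Theory Num.Theory.
Local Open Scope ring_scope.

(** Identify [B] with the group [G = (Z/p)^n] through exponents. A sum of [n]
    [p]-th roots of unity vanishes only if every root occurs equally often, so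
    [v . x = 0] forces the coordinate sum of [v + x] to be a constant [kappa].
    Hence the [x] of coordinate sum [kappa - s] are covered by the [d] vectors
    [v_i] of coordinate sum [s], and the product [f] of the linear forms
    [v_i . x] over these vectors vanishes on one class of the coordinate sum
    and nowhere else.
    The Fourier transform of [f] lives on exponents [a] of degree at most [d],
    where the degree is the sum of the representatives in [0, p).
    As [f] vanishes on a class, its transform satisfies a linear relation along
    each coset of the diagonal, so it is nonzero at both [a] and [a + (j,...,j)]
    for some [a] and [j != 0]. Coordinatewise
    [j a_l + (p - j) ((a_l + j) mod p) >= j (p - j)], which gives
    [p d >= n j (p - j) >= n (p - 1)]. Summing over the [p] classes of [v]
    yields the bound. *)

Lemma leq_mul_shift_mod (m x j : nat) : (j < m)%N ->
  (j * (m - j) <= j * x + (m - j) * ((x + j) %% m))%N.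
Proof.
move=> j_lt_m; have [xj_lt_m|m_le_xj] := ltnP (x + j) m.
  by rewrite modn_small //; nia.
by apply: leq_trans (leq_addr _ _); rewrite leq_mul2l; lia.
Qed.

Lemma sumr_neq0_exists (V : nmodType) (I : finType) (P : pred I) (F : I -> V) :
  \sum_(i | P i) F i != 0 -> exists2 i, P i & F i != 0.
Proof.
move=> sumF; suff /exists_inP[i] : [exists (i | P i), F i != 0] by exists i.
by apply: contraR sumF => /exists_inPn F0; rewrite big1 // => i /F0/negPn/eqP.
Qed.

Lemma sum_fibers (V : nmodType) (I J : finType) (c : I -> J) (F : J -> V) :
  \sum_i F (c i) = \sum_j F j *+ #|[set i | c i == j]|.
Proof.
rewrite (partition_big c xpredT) //=; apply: eq_bigr => j _.
by rewrite -sumr_const; apply: eq_big => [i | i /eqP->]; rewrite ?inE.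
Qed.

Lemma sum_card_fibers (I J : finType) (c : I -> J) :
  (\sum_j #|[set i | c i == j]| = #|I|)%N.
Proof.
rewrite -sum1_card; have /= -> := sum_fibers c (fun=> 1%N).
by apply: eq_bigr => j _; rewrite natn.
Qed.

Lemma sum_character_eq0 (G : finZmodType) (R : idomainType) (chi : G -> R) x :
  {morph chi : y z / y + z >-> y * z} -> chi x != 1 -> \sum_y chi y = 0.
Proof.
move=> chiD chix_neq1; set S := \sum_y _.
have chixS : chi x * S = S.
  rewrite [RHS](reindex_inj (addrI x)) mulr_sumr.
  by apply: eq_bigr => y _; rewrite chiD.
apply/eqP; move/eqP: chixS; rewrite -subr_eq0 -[X in _ - X]mul1r -mulrBl.
by rewrite mulf_eq0 subr_eq0 (negPf chix_neq1).
Qed.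

Section ExponentsModulo.

Variables (F : fieldType) (m : nat) (w : F).
Hypotheses (m_gt1 : (1 < m)%N) (w_prim : m.-primitive_root w).

Lemma card_Zm : #|{: 'Z_m}| = m.
Proof. by rewrite card_ord Zp_cast. Qed.

Lemma val_ZpD (a b : 'Z_m) : (a + b)%R = ((a + b) %% m)%N :> nat.
Proof. by rewrite /= [X in (_ %% X)%N]Zp_cast. Qed.

Lemma ltn_Zp (a : 'Z_m) : (a < m)%N.
Proof. by have := ltn_ord a; rewrite [X in (_ < X)%N -> _]Zp_cast. Qed.

Definition zexp (a : 'Z_m) : F := w ^+ a.

Lemma zexpD : {morph zexp : a b / a + b >-> a * b}.
Proof. by move=> a b; rewrite /zexp val_ZpD (prim_expr_mod w_prim) exprD. Qed.

Lemma zexp0 : zexp 0 = 1.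
Proof. exact: expr0. Qed.

Lemma zexp_eq1 a : (zexp a == 1) = (a == 0).
Proof. by rewrite /zexp -(prim_order_dvd w_prim) /dvdn modn_small ?ltn_Zp. Qed.

Lemma sum_zexp_mulr (c : 'Z_m) : c != 0 -> \sum_j zexp (j * c) = 0.
Proof.
move=> c_neq0; apply: (@sum_character_eq0 _ _ (fun j => zexp (j * c)) 1).
  by move=> i j; rewrite mulrDl zexpD.
by rewrite mul1r zexp_eq1.
Qed.

Lemma sum_zexp : \sum_a zexp a = 0.
Proof.
rewrite -[RHS](sum_zexp_mulr (oner_neq0 _)).
by apply: eq_bigr => a _; rewrite mulr1.
Qed.

Section FourierTransform.

Variable n : nat.
Implicit Types (a b c : 'rV['Z_m]_n) (f g : 'rV['Z_m]_n -> F) (v : 'rV[F]_n).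

Definition zdot a b : 'Z_m := (a *m b^T) 0 0.

Lemma zdotC a b : zdot a b = zdot b a.
Proof. by rewrite /zdot -[in LHS](trmxK a) -trmx_mul mxE. Qed.

Lemma zdotDl a b c : zdot (a + b) c = zdot a c + zdot b c.
Proof. by rewrite /zdot mulmxDl mxE. Qed.

Lemma zdotDr a b c : zdot a (b + c) = zdot a b + zdot a c.
Proof. by rewrite !(zdotC a) zdotDl. Qed.

Lemma zdotNl a b : zdot (- a) b = - zdot a b.
Proof. by rewrite /zdot mulNmx mxE. Qed.

Lemma zdotNr a b : zdot a (- b) = - zdot a b.
Proof. by rewrite !(zdotC a) zdotNl. Qed.

Lemma zdotZl t a b : zdot (t *: a) b = t * zdot a b.
Proof. by rewrite /zdot -scalemxAl mxE. Qed.

Lemma zdot0l b : zdot 0 b = 0.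
Proof. by rewrite /zdot mul0mx mxE. Qed.

Lemma zdot_delta l b : zdot (delta_mx 0 l) b = b 0 l.
Proof. by rewrite /zdot -rowE !mxE. Qed.

Definition zsum a : 'Z_m := \sum_l a 0 l.

Lemma zsum_delta t l : zsum (t *: delta_mx 0 l) = t.
Proof.
rewrite /zsum (bigD1 l) //= big1 => [|i /negPf i_neq_l]; last first.
  by rewrite !mxE i_neq_l andbF mulr0.
by rewrite !mxE !eqxx mulr1 addr0.
Qed.

Lemma zdot_const1 b : zdot (const_mx 1) b = zsum b.
Proof. by rewrite /zdot mxE; apply: eq_bigr => l _; rewrite !mxE mul1r. Qed.

Lemma sum_zexp_zdot a : a != 0 -> \sum_b zexp (zdot a b) = 0.
Proof.
case/rV0Pn=> l al_neq0.
apply: (@sum_character_eq0 _ _ (fun b => zexp (zdot a b)) (delta_mx 0 l)).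
  by move=> b c; rewrite zdotDr zexpD.
by rewrite zdotC zdot_delta zexp_eq1.
Qed.

Definition fourier f a : F := \sum_b f b * zexp (- zdot a b).

Lemma fourier_inversion f b :
  \sum_a fourier f a * zexp (zdot a b) = (m ^ n)%:R * f b.
Proof.
transitivity (\sum_c f c * \sum_a zexp (zdot (b - c) a)).
  under eq_bigr do rewrite mulr_suml.
  rewrite exchange_big; apply: eq_bigr => c _; rewrite mulr_sumr.
  apply: eq_bigr => a _.
  by rewrite -mulrA -zexpD addrC -zdotNr -zdotDr zdotC.
rewrite (bigD1 b) //= [X in _ + X]big1 ?addr0 => [|c c_neq_b]; last first.
  by rewrite sum_zexp_zdot ?mulr0 // subr_eq0 eq_sym.
rewrite subrr mulrC; congr (_ * _).
under eq_bigr do rewrite zdot0l zexp0.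
by rewrite sumr_const card_mx card_Zm mul1n.
Qed.

Lemma fourier_neq0 f b : f b != 0 -> exists a, fourier f a != 0.
Proof.
move=> fb_neq0.
have : \sum_a fourier f a * zexp (zdot a b) != 0.
  rewrite fourier_inversion mulf_neq0 // natrX expf_neq0 //.
  exact: prim_root_natf_neq0 w_prim.
by case/sumr_neq0_exists=> a _; rewrite mulf_eq0 => /norP[]; exists a.
Qed.

Lemma fourier_line_sum f c s a : (forall b, zdot c b = s -> f b = 0) ->
  \sum_j fourier f (a + j *: c) * zexp (j * s) = 0.
Proof.
move=> f_eq0.
transitivity
  (\sum_b f b * zexp (- zdot a b) * \sum_j zexp (j * (s - zdot c b))).
  under eq_bigr do rewrite mulr_suml.
  rewrite exchange_big; apply: eq_bigr => b _; rewrite mulr_sumr.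
  apply: eq_bigr => j _; rewrite -!mulrA -!zexpD zdotDl zdotZl opprD mulrBr.
  by rewrite -addrA [_ - j * _]addrC.
apply: big1 => b _; have [/f_eq0->|cb_neq_s] := eqVneq (zdot c b) s.
  by rewrite !mul0r.
by rewrite sum_zexp_mulr ?mulr0 // subr_eq0 eq_sym.
Qed.

Lemma fourier_line_neq0_pair f c s b0 : f b0 != 0 ->
    (forall b, zdot c b = s -> f b = 0) ->
  exists a j, [/\ j != 0, fourier f a != 0 & fourier f (a + j *: c) != 0].
Proof.
case/fourier_neq0=> a fa_neq0 /(fourier_line_sum a)/eqP.
rewrite (bigD1 0) //= scale0r addr0 mul0r zexp0 mulr1 addr_eq0 => /eqP fa_eq.
move: (fa_neq0); rewrite fa_eq oppr_eq0 => /sumr_neq0_exists[j j_neq0].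
by rewrite mulf_eq0 => /norP[faj_neq0 _]; exists a, j.
Qed.

Definition zdeg a : nat := (\sum_l nat_of_ord (a ord0 l))%N.

Lemma zdeg0 : zdeg 0 = 0%N.
Proof. by apply: big1 => l _; rewrite mxE. Qed.

Lemma zdegD a b : (zdeg (a + b)%R <= zdeg a + zdeg b)%N.
Proof.
by rewrite -big_split; apply: leq_sum => l _; rewrite mxE val_ZpD leq_mod.
Qed.

Lemma zdeg_delta l : zdeg (delta_mx 0 l) = 1%N.
Proof.
rewrite /zdeg (bigD1 l) //= big1 => [|i /negPf i_neq_l].
  by rewrite mxE !eqxx.
by rewrite mxE i_neq_l andbF.
Qed.

Lemma zdeg_shift a (j : 'Z_m) :
  (n * (j * (m - j)) <=
     j * zdeg a + (m - j) * zdeg (a + j *: const_mx 1)%R)%N.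
Proof.
rewrite /zdeg !big_distrr -big_split /= -[n in (n * _)%N]card_ord.
rewrite -sum_nat_const; apply: leq_sum => l _.
by rewrite !mxE mulr1 val_ZpD leq_mul_shift_mod ?ltn_Zp.
Qed.

Definition linform v b : F := \sum_l v 0 l * zexp (b 0 l).

Definition fourier_degree_le f d : Prop :=
  forall a, fourier f a != 0 -> (zdeg a <= d)%N.

Lemma fourier_degree_le1 : fourier_degree_le (fun=> 1) 0.
Proof.
move=> a; apply: contraR; rewrite -ltnNge => a_gt0; apply/eqP.
rewrite /fourier; under eq_bigr do rewrite mul1r -zdotNl.
apply: sum_zexp_zdot; rewrite oppr_eq0.
by apply: contraTneq a_gt0 => ->; rewrite zdeg0.
Qed.

Lemma fourier_mul_linform f v a :
  fourier (fun b => linform v b * f b) a =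
  \sum_l v 0 l * fourier f (a - delta_mx 0 l).
Proof.
under [RHS]eq_bigr do rewrite mulr_sumr.
rewrite exchange_big; apply: eq_bigr => b _; rewrite -mulrA mulr_suml.
apply: eq_bigr => l _; rewrite -mulrA; congr (_ * _).
by rewrite zdotDl zdotNl zdot_delta opprB zexpD mulrCA.
Qed.

Lemma fourier_degree_le_mul_linform f d v :
  fourier_degree_le f d -> fourier_degree_le (fun b => linform v b * f b) d.+1.
Proof.
move=> f_le_d a; rewrite fourier_mul_linform => /sumr_neq0_exists[l _].
rewrite mulf_eq0 => /norP[_ /f_le_d al_le_d].
rewrite -[a](subrK (delta_mx 0 l)) (leq_trans (zdegD _ _)) //.
by rewrite zdeg_delta addn1.
Qed.

Lemma eq_fourier_degree_le f g d :
  f =1 g -> fourier_degree_le f d -> fourier_degree_le g d.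
Proof.
move=> eq_fg f_le_d a.
by rewrite /fourier; under eq_bigr do rewrite -eq_fg; apply: f_le_d.
Qed.

Lemma fourier_degree_le_prod_linform (I : finType) (A : {pred I})
    (v : I -> 'rV[F]_n) :
  fourier_degree_le (fun b => \prod_(i in A) linform (v i) b) #|A|.
Proof.
apply: (@eq_fourier_degree_le
          (fun b => \prod_(i <- enum A) linform (v i) b)).
  by move=> b; rewrite big_enum.
rewrite cardE; elim: (enum A) => [|i r IHr] /=.
  by apply: (eq_fourier_degree_le _ fourier_degree_le1) => b; rewrite big_nil.
have := fourier_degree_le_mul_linform (v := v i) IHr.
by apply: eq_fourier_degree_le => b; rewrite big_cons.
Qed.

Lemma fourier_degree_lower_bound f d s b0 :
    fourier_degree_le f d -> f b0 != 0 ->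
    (forall b, zsum b = s -> f b = 0) ->
  (n * m.-1 <= m * d)%N.
Proof.
move=> f_le_d fb0_neq0 f_eq0.
have [b|a [j [j_neq0 /f_le_d a_le_d /f_le_d aj_le_d]]] :=
    fourier_line_neq0_pair (c := const_mx 1) (s := s) fb0_neq0.
  by rewrite zdot_const1; apply: f_eq0.
have j_lt_m := ltn_Zp j.
have m1_le : (m.-1 <= j * (m - j))%N.
  by have : (0 < j)%N; [rewrite lt0n | nia].
apply: leq_trans (leq_trans (zdeg_shift a j) _); first by rewrite leq_mul.
by rewrite -[m in leqRHS](subnKC (ltnW j_lt_m)) mulnDl leq_add // leq_mul.
Qed.

Lemma linform_cover_bound (I : finType) (A : {pred I})
    (v : I -> 'rV[F]_n) s b0 :
    (forall b, zsum b = s -> exists2 i, i \in A & linform (v i) b = 0) ->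
    {in A, forall i, linform (v i) b0 != 0} ->
  (n * m.-1 <= m * #|A|)%N.
Proof.
move=> cover avoid.
apply: (fourier_degree_lower_bound (b0 := b0) (s := s)).
- exact: (fourier_degree_le_prod_linform (v := v)).
- exact/prodf_neq0.
- by move=> b /cover[i Ai vb_eq0]; rewrite (bigD1 i) //= vb_eq0 mul0r.
Qed.

End FourierTransform.
End ExponentsModulo.

Lemma inBP (n m : nat) (w : algC) (v : 'rV[algC]_n) : (1 < m)%N ->
  inB m w v <-> exists a : 'rV['Z_m]_n, v = map_mx (zexp w) a.
Proof.
move=> m_gt1; split=> [/fin_all_exists[j vj] | [a ->] l]; last first.
  by exists (a 0 l); rewrite ltn_Zp // mxE.
exists (\row_l inZp (j l)); apply/rowP => l; have [j_lt_m ->] := vj l.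
by rewrite !mxE /zexp /= [X in (_ %% X)%N]Zp_cast ?modn_small.
Qed.

Lemma dot_map_zexp (n m : nat) (w : algC) (v : 'rV[algC]_n)
    (b : 'rV['Z_m]_n) :
  dot v (map_mx (zexp w) b) = linform w v b.
Proof. by apply: eq_bigr => l _; rewrite mxE. Qed.

Lemma size_minCpoly_prim_root (m : nat) (w : algC) :
  m.-primitive_root w -> size (minCpoly w) = (totient m).+1.
Proof. by move/minCpoly_cyclotomic->; rewrite size_cyclotomic. Qed.

Lemma prim_root_ratpoly_eq0 (m : nat) (w : algC) (P : {poly rat}) :
    m.-primitive_root w -> root (map_poly ratr P) w ->
    (size P <= totient m)%N ->
  P = 0.
Proof.
move=> w_prim Pw_eq0; apply: contraTeq => P_neq0; rewrite -ltnNge.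
have [Q [minQ _ dvQ]] := minCpolyP w.
rewrite -(size_minCpoly_prim_root w_prim) minQ size_map_poly.
by rewrite dvdp_leq // -dvQ.
Qed.

Section VanishingSums.

Variables (p : nat) (w : algC).
Hypotheses (p_prime : prime p) (w_prim : p.-primitive_root w).

Let p_gt1 : (1 < p)%N := prime_gt1 p_prime.

Lemma rat_relation_prim_root_const (a : 'Z_p -> rat) :
  \sum_t ratr (a t) * zexp w t = 0 -> forall t, a t = a ord_max.
Proof.
have ord_maxP (t : 'Z_p) : (Zp_trunc p < t)%N -> t = ord_max.
  by move=> t_ge; apply/val_inj/eqP; rewrite eqn_leq t_ge -ltnS ltn_ord.
move=> rel t; have [t_lt|/ord_maxP-> //] := ltnP t (Zp_trunc p).+1.
pose P : {poly rat} := \poly_(i < (Zp_trunc p).+1) (a (inord i) - a ord_max).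
suff /polyP/(_ t) : P = 0.
  by rewrite coef_poly t_lt coef0 inord_val => /eqP; rewrite subr_eq0 => /eqP.
have P_size : (size P <= (Zp_trunc p).+1)%N by exact: size_poly.
apply: (prim_root_ratpoly_eq0 w_prim); last first.
  by rewrite totient_prime // -ltnS prednK ?prime_gt0 // -[leqRHS]Zp_cast.
have relB : \sum_t ratr (a t - a ord_max) * zexp w t = 0.
  under eq_bigr do rewrite rmorphB mulrBl.
  by rewrite sumrB rel -mulr_sumr sum_zexp // mulr0 subr0.
rewrite /root (@horner_coef_wide _ (Zp_trunc p).+2) ?size_map_poly 1?leqW //.
rewrite -[X in _ == X]relB; apply/eqP/eq_bigr => i _.
rewrite coef_map coef_poly; case: ltnP => [_|/ord_maxP->].
  by rewrite inord_val.
by rewrite subrr.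
Qed.

Lemma vanishing_sum_equidistributed (I : finType) (c : I -> 'Z_p) :
  \sum_i zexp w (c i) = 0 -> forall t, #|[set i | c i == t]| = (#|I| %/ p)%N.
Proof.
rewrite sum_fibers => rel.
have fiber_const t : #|[set i | c i == t]| = #|[set i | c i == ord_max]|.
  apply/eqP; rewrite -(eqr_nat rat); apply/eqP; move: t.
  apply: rat_relation_prim_root_const; rewrite -[RHS]rel.
  by apply: eq_bigr => t _; rewrite ratr_nat mulr_natl.
suff -> : #|I| = (#|[set i | c i == ord_max]| * p)%N.
  by move=> t; rewrite mulnK ?prime_gt0.
rewrite -(sum_card_fibers c); under eq_bigr do rewrite fiber_const.
by rewrite sum_nat_const card_Zm // mulnC.
Qed.

Lemma vanishing_sum_exponents (I : finType) (c : I -> 'Z_p) :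
  \sum_i zexp w (c i) = 0 -> \sum_i c i = (\sum_t t) *+ (#|I| %/ p).
Proof.
move=> /vanishing_sum_equidistributed fiber_card.
rewrite (sum_fibers c id) -sumrMnl.
by apply: eq_bigr => t _; rewrite fiber_card.
Qed.

Variable n : nat.

Lemma orthogonal_zsum (a b : 'rV['Z_p]_n) :
    dot (map_mx (zexp w) a) (map_mx (zexp w) b) = 0 ->
  zsum a + zsum b = (\sum_t t) *+ (n %/ p).
Proof.
move=> ab_eq0; rewrite -big_split -[n in RHS]card_ord.
apply: vanishing_sum_exponents; rewrite -[RHS]ab_eq0.
by apply: eq_bigr => l _; rewrite !mxE zexpD.
Qed.

Lemma zsum_class_bound (I : finType) (A : I -> 'rV['Z_p]_n) s : (0 < n)%N ->
    (forall b : 'rV['Z_p]_n, exists i,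
       dot (map_mx (zexp w) (A i)) (map_mx (zexp w) b) = 0) ->
  (n * p.-1 <= p * #|[set i | zsum (A i) == s]|)%N.
Proof.
move=> n_gt0 cover; pose kappa : 'Z_p := (\sum_t t) *+ (n %/ p).
apply: (linform_cover_bound p_gt1 w_prim (s := kappa - s)
          (v := fun i => map_mx (zexp w) (A i))
          (b0 := (kappa - s + 1) *: delta_mx 0 (Ordinal n_gt0))).
  move=> b b_class; have [i Aib] := cover b.
  exists i; last by rewrite -dot_map_zexp.
  by rewrite inE (canRL (addrK _) (orthogonal_zsum Aib)) b_class subKr.
move=> i; rewrite inE => /eqP Ai_class; apply/eqP.
rewrite -dot_map_zexp => /orthogonal_zsum/eqP.
by rewrite Ai_class zsum_delta addrA subrKC -subr_eq0 addrC addrK oner_eq0.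
Qed.

End VanishingSums.

Theorem theorem1 (n p : nat) (w : algC) :
  (0 < n)%N -> prime p -> (p %| n)%N -> p.-primitive_root w ->
  forall (k : nat) (v : 'I_k -> 'rV[algC]_n),
    (forall i, inB p w (v i)) ->
    (forall x : 'rV[algC]_n, inB p w x -> exists i : 'I_k, dot (v i) x = 0) ->
    (n * (p - 1) <= k)%N.
Proof.
move=> n_gt0 p_prime _ w_prim k v vB cover.
have [A vA] := fin_all_exists (fun i => (inBP w (v i) (prime_gt1 p_prime)).1 (vB i)).
have exponent_cover (b : 'rV['Z_p]_n) :
    exists i, dot (map_mx (zexp w) (A i)) (map_mx (zexp w) b) = 0.
  have [|i vib_eq0] := cover (map_mx (zexp w) b).
    by apply/inBP; [exact: prime_gt1 | exists b].
  by exists i; rewrite -vA.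
have -> : k = (\sum_s #|[set i | zsum (A i) == s]|)%N.
  by rewrite sum_card_fibers card_ord.
rewrite subn1 -(leq_pmul2l (prime_gt0 p_prime)) big_distrr /=.
have -> : (p * (n * p.-1) = \sum_(s : 'Z_p) n * p.-1)%N.
  by rewrite sum_nat_const card_Zm ?prime_gt1.
by apply: leq_sum => s _; apply: zsum_class_bound exponent_cover.
Qed.
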